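(* Let $n,k,l$ be integers with $n\geq 1$, $k\geq 2$ and $0\leq l\leq k-2$. The number of $(k,l)$-threshold sequences of length $n$ is equal to the Raney number $$R_n^{(k,l+1)}=\frac{l+1}{kn+l+1}\binom{kn+l+1}{n}.$$
   Context: A $(k,l)$-threshold sequence of length $n$ is a strictly increasing sequence $S=(s_1s_2\ldots s_n)$ of integers such that $ki\leq s_i\leq kn+l$ for all $1\le i\le n$. Raney numbers are $R_n^{(k,r)}=\frac{r}{kn+r}\binom{kn+r}{n}$. *)

(* Defs.v *)
From HB Require Import structures.
From mathcomp Require Import all_boot all_order all_algebra.
From mathcomp Require Import finmap.
From mathcomp Require Import boolp classical_sets functions cardinality.

Set Implicit Arguments.
Unset Strict Implicit.
Unset Printing Implicit Defensive.

Import Order.TTheory GRing.Theory Num.Theory.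

Local Open Scope classical_set_scope.
Local Open Scope ring_scope.

(* The term s_i (1 <= i <= n) is [tnth s] at the 0-based index i - 1, so the
   lower bound k * i reads [k * i.+1]. *)
Definition threshold_seq (k l n : nat) (s : n.-tuple int) : bool :=
  sorted <%R s &&
  [forall i : 'I_n, (k * i.+1)%:Z <= tnth s i <= (k * n + l)%:Z].

Definition threshold_seqs (k l n : nat) : set (n.-tuple int) :=
  [set s | threshold_seq k l s].
Arguments threshold_seqs k l n : clear implicits.

Definition raney (k r n : nat) : rat :=
  r%:R / (k * n + r)%:R * 'C(k * n + r, n)%:R.

(* Main.v *)
(* Let f n m be the number of (s_1 < ... < s_n) with k i <= s_i < m.  Splitting
   off the last term gives f (n+1) m = \sum_(k (n+1) <= j < m) f n j, and for
   k n <= m this is solved by f n m = 'C(m, n) - k 'C(m - 1, n - 1): the right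
   hand side obeys Pascal's rule and vanishes at m = k n.  At m = k n + l + 1
   the solution is the Raney number. *)
Require Import Defs.
From HB Require Import structures.
From mathcomp Require Import all_boot all_order all_algebra.
From mathcomp Require Import finmap.
From mathcomp Require Import boolp classical_sets functions cardinality.
From mathcomp Require Import zify.

Set Implicit Arguments.
Unset Strict Implicit.
Unset Printing Implicit Defensive.

Import Order.TTheory GRing.Theory Num.Theory.

Local Open Scope classical_set_scope.
Local Open Scope fset_scope.
Local Open Scope ring_scope.

Fixpoint threshold_enum (k n m : nat) : seq (n.-tuple int) :=
  match n with
  | 0 => [:: [tuple]]
  | p.+1 => [seq rcons_tuple t j%:Z | j <- index_iota (k * p.+1) m,
                                           t <- threshold_enum k p j]
  end.

(** Phrased on plain sequences, with order as [pairwise], so that both conditions split when a last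
    term is appended. *)
Definition below_threshold (k m : nat) (s : seq int) : bool :=
  pairwise <%R s &&
  all (fun i => (k * i.+1)%:Z <= s`_i < m%:Z) (iota 0 (size s)).

(** The appended term takes over as strict upper bound: [s] can be followed by [j] exactly when its
    terms lie below [j], and then they lie below [m] too. *)
Lemma below_threshold_rcons (k m : nat) (s : seq int) (j : nat) :
  below_threshold k m (rcons s j%:Z) =
  (k * (size s).+1 <= j < m)%N && below_threshold k j s.
Proof.
rewrite /below_threshold pairwise_rcons size_rcons -[in iota _ _]addn1 iotaD all_cat /=.
rewrite add0n nth_rcons ltnn eqxx andbT !lez_nat !ltz_nat.
have nthE i : i \in iota 0 (size s) -> (rcons s j%:Z)`_i = s`_i.
  by rewrite mem_iota add0n /= nth_rcons => ->.
apply/idP/idP.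
  case/andP=> /andP[/all_nthP-/(_ 0) ltsj ->] /andP[/allP lb ->] /=.
  apply/allP => i si; have := lb i si.
  rewrite nthE // => /andP[-> _] /=; apply: ltsj.
  by move: si; rewrite mem_iota.
case/andP=> /[dup] /andP[_ ltjm] -> /andP[-> /allP lb]; rewrite !andbT.
apply/andP; split.
  apply/(all_nthP 0) => i si; have := lb i; rewrite mem_iota add0n si.
  by case/(_ isT)/andP.
apply/allP => i si; rewrite nthE //; have /andP[-> /lt_trans] := lb i si.
by apply; rewrite ltz_nat.
Qed.

Lemma mem_threshold_enum (k n m : nat) (s : n.-tuple int) :
  (s \in threshold_enum k n m) = below_threshold k m s.
Proof.
elim: n m s => [|n IHn] m s; first by rewrite tuple0 mem_seq1 eqxx.
apply/allpairsPdep/idP => [[j [t [jP tP ->]]]|].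
  rewrite below_threshold_rcons size_tuple -IHn tP andbT.
  by move: jP; rewrite mem_index_iota.
case/tupleP: s => x s sP.
have sE : [tuple of x :: s] = [tuple of rcons (belast x s) (last x s)].
  by apply: val_inj; rewrite /= lastI.
move: sP; rewrite sE; set t := belast_tuple x s; set y := last x s => yP.
(* The lower bound [k * n.+1] on the last term rules out the negative constructor of [int]. *)
have [j yE] : exists j : nat, y = j%:Z.
  move: yP; rewrite /below_threshold => /andP[_ /allP/(_ n)].
  rewrite mem_iota /= size_rcons size_belast size_tuple ltnSn => /(_ isT).
  rewrite nth_rcons size_belast size_tuple ltnn eqxx.
  by case: (y) => [j|j] // _; exists j.
move: yP; rewrite yE (below_threshold_rcons k m t) size_tuple => /andP[jP tP].
exists j, t; split; rewrite ?mem_index_iota ?IHn //.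
Qed.

Lemma threshold_enum_uniq (k n m : nat) : uniq (threshold_enum k n m).
Proof.
elim: n m => // n IHn m; apply: allpairs_uniq_dep; first exact: iota_uniq.
  by move=> j _; apply: IHn.
move=> [j t] [j' t'] _ _ /(congr1 val)/= /rcons_inj[/val_inj tE jE].
by rewrite jE tE.
Qed.

(** The additive form avoids truncated subtraction. The factor [n != 0] removes the correction at
    [n = 0], where [n.-1] would be [0] and the binomial [1]. *)
Lemma size_threshold_enum (k n m : nat) : (k * n <= m)%N ->
  (size (threshold_enum k n m) + k * (n != 0) * 'C(m.-1, n.-1) = 'C(m, n))%N.
Proof.
elim: n m => [|n IHn] m le_knm; first by rewrite muln0 bin0.
rewrite muln1 /= size_allpairs_dep sumnE big_map.
rewrite -(subnKC le_knm); elim: (m - _)%N => {m le_knm} [|d IHd].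
  (* At [m = k * n.+1] the sum is empty; multiplying by [n.+1] reduces the claim to the absorption
     identity [m * 'C(m.-1, n) = n.+1 * 'C(m, n.+1)]. *)
  rewrite addn0 /index_iota subnn big_nil add0n.
  apply/eqP; rewrite -(eqn_pmul2l (ltn0Sn n)) -mul_bin_diag; apply/eqP; lia.
rewrite addnS big_nat_recr ?leq_addr //= binS.
move: IHd; move jE: (k * n.+1 + d)%N => j <-.
have := IHn j ltac:(lia).
case: n {IHn} jE => [|n] jE /=; first by rewrite !bin0; lia.
(* Pascal's rule for ['C(j, n.+1)] requires [0 < j], which can fail only for [k = 0]; there the
   correction terms vanish. *)
case: k jE => [|p] jE; first by rewrite !mul0n; lia.
have -> : j = j.-1.+1 by lia.
rewrite binS /=; lia.
Qed.

(** The inclusive bound [k * n + l] becomes the strict bound given by its successor. *)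
Lemma threshold_seqs_enum (k l n : nat) :
  threshold_seqs k l n = [set` threshold_enum k n (k * n + l).+1].
Proof.
apply/seteqP; split=> s /=; rewrite mem_threshold_enum;
  rewrite /threshold_seqs /mkset /threshold_seq lt_sorted_pairwise /below_threshold size_tuple => /andP[-> /= sP].
  apply/allP => i; rewrite mem_iota add0n /= => ltin.
  have := forallP sP (Ordinal ltin); rewrite (tnth_nth 0) /=.
  by rewrite -ltzD1 intS addrC.
apply/forallP => i; move/allP/(_ (val i)): sP.
rewrite mem_iota add0n ltn_ord (tnth_nth 0) => /(_ isT) /=.
by rewrite intS addrC ltzD1.
Qed.

Theorem corollary3p7 (n k l : nat) (hn : (1 <= n)%N) (hk : (2 <= k)%N)
  (hl : (l <= k - 2)%N) :
  finite_set (threshold_seqs k l n) /\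
  (#|` fset_set (threshold_seqs k l n)|)%:R = raney k l.+1 n.
Proof.
rewrite threshold_seqs_enum; set s := threshold_enum _ _ _.
have fin_s : finite_set [set` s] by exact: finite_seq.
split=> //.
have -> : fset_set [set` s] = [fset t in s].
  by apply/fsetP => t; rewrite in_fset_set // mem_setE inE.
rewrite card_fseq undup_id ?threshold_enum_uniq //.
(* With [m = k * n + l.+1], absorption gives [m * 'C(m.-1, n.-1) = n * 'C(m, n)], so [m] times the
   count is [(m - k * n) * 'C(m, n)], and [m - k * n = l.+1]. *)
have sizeE : (size s * (k * n + l.+1) = l.+1 * 'C(k * n + l.+1, n))%N.
  have := @size_threshold_enum k n (k * n + l).+1 ltac:(lia).
  have := mul_bin_diag (k * n + l).+1 n.-1.
  rewrite -/s addnS prednK //= -lt0n hn; nia.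
rewrite /raney mulrAC -natrM -sizeE natrM mulfK //.
by rewrite pnatr_eq0 addnS.
Qed.
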